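(* For every cooperative interval game $(N,w)$ we have $\mathrm{gen}(\mathcal{C}(w)) = \mathcal{SC}(w)$ if and only if for every $x\in\mathcal{SC}(w)$ there exist nonnegative vectors $l^{(x)},u^{(x)}\in\mathbb{R}^N$ such that $$\sum_{i\in N}(x_i-l^{(x)}_i)=\underline{w}(N),$$ $$\sum_{i\in N}(x_i+u^{(x)}_i)=\overline{w}(N),$$ $$\sum_{i\in S}(x_i-l^{(x)}_i)\ge\underline{w}(S)\quad\forall S\in 2^N\setminus\{\emptyset\},$$ $$\sum_{i\in S}(x_i+u^{(x)}_i)\ge\overline{w}(S)\quad\forall S\in 2^N\setminus\{\emptyset\}.$$
   Context: Let $N=\{1,2,\ldots,n\}$ be a set of players, $2^N$ its power set, and $\mathbb{IR}$ the set of all closed real intervals $X=[\underline{X},\overline{X}]$. Interval addition is $X+Y=[\underline{X}+\underline{Y},\overline{X}+\overline{Y}]$, and $I\succeq J$ means $\underline{I}\ge\underline{J}$ and $\overline{I}\ge\overline{J}$. A (classical) cooperative game is a pair $(N,v)$ with $v:2^N\to\mathbb{R}$ and $v(\emptyset)=0$. A cooperative interval game is a pair $(N,w)$ with $w:2^N\to\mathbb{IR}$ and $w(\emptyset)=[0,0]$; write $w(i)$ for $w(\{i\})$, and $\underline{w}(S)$, $\overline{w}(S)$ for the lower and upper bound of $w(S)$. A selection of $(N,w)$ is a cooperative game $(N,v)$ with $v(S)\in w(S)$ for every $S\in 2^N$; $\mathrm{Sel}(w)$ is the set of all selections. For a cooperative game $v$, the imputation set is $I(v)=\{x\in\mathbb{R}^N: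 \sum_{i\in N}x_i=v(N),\ x_i\ge v(\{i\})\ \forall i\in N\}$ and the core is $C(v)=\{x\in I(v): \sum_{i\in S}x_i\ge v(S)\ \forall S\subseteq N\}$. The selection core is $\mathcal{SC}(w)=\bigcup\{C(v): v\in\mathrm{Sel}(w)\}\subseteq\mathbb{R}^N$. The set of interval imputations is $\mathcal{I}(w)=\{(I_1,\ldots,I_n)\in\mathbb{IR}^N: \sum_{i\in N}I_i=w(N),\ I_i\succeq w(i)\ \forall i\in N\}$ and the interval core is $\mathcal{C}(w)=\{(I_1,\ldots,I_n)\in\mathcal{I}(w): \sum_{i\in S}I_i\succeq w(S)\ \forall S\in 2^N\setminus\{\emptyset\}\}$. For a set $A\subseteq\mathbb{IR}^N$ of interval vectors, $\mathrm{gen}(A)=\bigcup_{s\in A}\{(x_1,\ldots,x_n)\in\mathbb{R}^N: x_i\in s_i\ \forall i\in N\}$. *)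

(* Defs.v *)
From HB Require Import structures.
From mathcomp Require Import all_boot all_order all_algebra.
From mathcomp Require Export boolp classical_sets reals.

Set Implicit Arguments.
Unset Strict Implicit.
Unset Printing Implicit Defensive.

Import Order.TTheory GRing.Theory Num.Theory.
Local Open Scope classical_set_scope.
Local Open Scope ring_scope.

(* Coalitions are finite sets in {set 'I_n}; the qualified finset.set0 and the
   scope %SET select them over the classical sets of the same notation. *)

Section ClosedIntervals.
Variable R : realType.

(* Nonempty closed intervals [lo, hi], carried by the pair of their bounds, so
   that Leibniz equality is equality of the bounds. *)
Record citv := CItv { bounds : R * R; bounds_le : bounds.1 <= bounds.2 }.

HB.instance Definition _ := [isSub for bounds].
HB.instance Definition _ := [Choice of citv by <:].

Definition lo (X : citv) : R := (bounds X).1.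
Definition hi (X : citv) : R := (bounds X).2.

Definition citv_set (X : citv) : set R := [set` `[lo X, hi X]].

Definition citv0 : citv := @CItv (0, 0) (lexx 0).

Definition citv_add (X Y : citv) : citv :=
  @CItv (lo X + lo Y, hi X + hi Y) (lerD (bounds_le X) (bounds_le Y)).

Fact citv_addA : associative citv_add.
Proof. by move=> X Y Z; apply: val_inj; rewrite /= /lo /hi /= !addrA. Qed.

Fact citv_addC : commutative citv_add.
Proof.
by move=> X Y; apply: val_inj; rewrite /= (addrC (lo X)) (addrC (hi X)).
Qed.

Fact citv_add0 : left_id citv0 citv_add.
Proof. by case=> -[a b] ab; apply: val_inj; rewrite /= /lo /hi /= !add0r. Qed.

(* Gives meaning to 0 = [0, 0], to X + Y and to \sum on intervals. *)
HB.instance Definition _ :=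
  GRing.isNmodule.Build citv citv_addA citv_addC citv_add0.

Definition citv_succeq (X Y : citv) : Prop := lo Y <= lo X /\ hi Y <= hi X.

End ClosedIntervals.

Notation "X ⪰ Y" := (citv_succeq X Y) (at level 70, no associativity).

Section Games.
Variables (R : realType) (n : nat).

Record game := Game {
  game_val :> {set 'I_n} -> R;
  game_val0 : game_val finset.set0 = 0 }.

Record interval_game := IntervalGame {
  igame_val :> {set 'I_n} -> citv R;
  igame_val0 : igame_val finset.set0 = 0 }.

Implicit Types (v : game) (w : interval_game).

Definition imputations v : set 'rV[R]_n :=
  [set x | \sum_(i < n) x ord0 i = v [set: 'I_n]%SET /\
           forall i, v [set i]%SET <= x ord0 i].

Definition core v : set 'rV[R]_n :=
  [set x | imputations v x /\
           forall S : {set 'I_n}, v S <= \sum_(i in S) x ord0 i].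

Definition selections w : set game :=
  [set v | forall S : {set 'I_n}, citv_set (w S) (v S)].

Definition selection_core w : set 'rV[R]_n :=
  \bigcup_(v in selections w) core v.

Definition interval_imputations w : set 'rV[citv R]_n :=
  [set s | \sum_(i < n) s ord0 i = w [set: 'I_n]%SET /\
           forall i, s ord0 i ⪰ w [set i]%SET].

Definition interval_core w : set 'rV[citv R]_n :=
  [set s | interval_imputations w s /\
           forall S : {set 'I_n}, S != finset.set0 ->
             \sum_(i in S) s ord0 i ⪰ w S].

Definition gen (A : set 'rV[citv R]_n) : set 'rV[R]_n :=
  \bigcup_(s in A) [set x | forall i, citv_set (s ord0 i) (x ord0 i)].

End Games.

(* Main.v *)
(* If [x] is generated by the interval core, then truncating the additive game
   [S |-> x(S)] at the upper bounds of [w] gives a selection whose core contains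
   [x], so gen(C(w)) is always contained in SC(w). Conversely, the vectors [l]
   and [u] are exactly the data of an interval core element
   [s_i = [x_i - l_i, x_i + u_i]] generating [x]. *)
Require Import Defs.
From mathcomp Require Import all_boot all_order all_algebra.
From mathcomp Require Import boolp classical_sets reals.

Import Order.TTheory GRing.Theory Num.Theory.
Local Open Scope classical_set_scope.
Local Open Scope ring_scope.

Lemma lo_sum (R : realType) (I : Type) (r : seq I) (P : pred I)
    (F : I -> citv R) :
  lo (\sum_(i <- r | P i) F i) = \sum_(i <- r | P i) lo (F i).
Proof. exact: (big_morph (@lo R) (fun _ _ => erefl) erefl). Qed.

Lemma hi_sum (R : realType) (I : Type) (r : seq I) (P : pred I)
    (F : I -> citv R) :
  hi (\sum_(i <- r | P i) F i) = \sum_(i <- r | P i) hi (F i).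
Proof. exact: (big_morph (@hi R) (fun _ _ => erefl) erefl). Qed.

(** Beyond its bounds an interval carries only a proof of a boolean inequality, which [val_inj]
    discards. *)
Lemma citv_eq (R : realType) (X Y : citv R) :
  lo X = lo Y -> hi X = hi Y -> X = Y.
Proof.
case: X Y => [[a b] ab] [[c d] cd]; rewrite /lo /hi /= => ac bd.
by apply: val_inj; rewrite /= ac bd.
Qed.

Lemma gen_interval_core_sub (R : realType) (n : nat) (w : interval_game R n) :
  gen (interval_core w) `<=` selection_core w.
Proof.
move=> x [s [[sN _] sS] /= xs].
have xlo i : lo (s ord0 i) <= x ord0 i.
  by have := xs i; rewrite /citv_set /= in_itv => /andP[].
have xhi i : x ord0 i <= hi (s ord0 i).
  by have := xs i; rewrite /citv_set /= in_itv => /andP[].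
pose f (S : {set 'I_n}) := Num.min (\sum_(i in S) x ord0 i) (hi (w S)).
have f0 : f finset.set0 = 0 by rewrite /f big_set0 igame_val0 minxx.
(* Truncation keeps [f S] above [lo (w S)]: both terms of the minimum are at least [lo (w S)], the
   first one through [s]. The interval core says nothing about the empty coalition, hence the case
   split. *)
have wx (S : {set 'I_n}) : lo (w S) <= \sum_(i in S) x ord0 i.
  have [->|S0] := eqVneq S finset.set0; first by rewrite big_set0 igame_val0.
  have [h _] := sS S S0; apply: le_trans h _.
  by rewrite lo_sum; apply: ler_sum.
exists (Game f0).
  move=> S; rewrite /citv_set /= in_itv /= le_min wx ge_min lexx orbT andbT /=.
  exact: bounds_le.
have fS S : f S <= \sum_(i in S) x ord0 i by rewrite /f ge_min lexx.
split=> //; split=> [|i] /=.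
  have -> : \sum_(i < n) x ord0 i = \sum_(i in [set: 'I_n]%SET) x ord0 i.
    by apply: eq_bigl => i; rewrite finset.in_setT.
  (* Efficiency survives because the truncation is inactive at the grand coalition: [x] sums to at
     most the upper bound of the sum of [s], which is [hi (w N)]. *)
  rewrite /f min_l // -sN hi_sum.
  under eq_bigl do rewrite finset.in_setT.
  by apply: ler_sum.
by have := fS [set i]%SET; rewrite big_set1.
Qed.

(** Being pointwise in [x] and free of selections, this reduces the theorem to comparing
    [gen (interval_core w)] with [selection_core w]. *)
Lemma gen_interval_coreP (R : realType) (n : nat) (w : interval_game R n)
    (x : 'rV[R]_n) :
  gen (interval_core w) x <->
    exists l u : 'rV[R]_n,
      (forall i, 0 <= l ord0 i) /\
      (forall i, 0 <= u ord0 i) /\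
      \sum_(i < n) (x ord0 i - l ord0 i) = lo (w [set: 'I_n]%SET) /\
      \sum_(i < n) (x ord0 i + u ord0 i) = hi (w [set: 'I_n]%SET) /\
      (forall S : {set 'I_n}, S != finset.set0 ->
        lo (w S) <= \sum_(i in S) (x ord0 i - l ord0 i)) /\
      (forall S : {set 'I_n}, S != finset.set0 ->
        hi (w S) <= \sum_(i in S) (x ord0 i + u ord0 i)).
Proof.
split=> [[s [[sN _] sS] /= xs]|[l [u [l0 [u0 [lN [uN [lS uS]]]]]]]].
  exists (\row_i (x ord0 i - lo (s ord0 i))), (\row_i (hi (s ord0 i) - x ord0 i)).
  have El i : x ord0 i - (\row_i (x ord0 i - lo (s ord0 i))) ord0 i
      = lo (s ord0 i) by rewrite mxE subKr.
  have Eu i : x ord0 i + (\row_i (hi (s ord0 i) - x ord0 i)) ord0 i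
      = hi (s ord0 i) by rewrite mxE addrC subrK.
  (* Nonnegativity of [l] and of [u] are the two halves of the membership of [x_i] in [s_i]. *)
  do 2![split=> [i|]; first by
    have := xs i; rewrite /citv_set /= in_itv mxE subr_ge0 => /andP[]].
  rewrite (eq_bigr _ (fun i _ => El i)) (eq_bigr _ (fun i _ => Eu i)).
  rewrite -lo_sum -hi_sum sN; do 2![split=> //].
  split=> S /sS[]; rewrite lo_sum hi_sum => hl hu.
    by rewrite (eq_bigr _ (fun i _ => El i)).
  by rewrite (eq_bigr _ (fun i _ => Eu i)).
have lex i : x ord0 i - l ord0 i <= x ord0 i by rewrite gerBl.
have xle i : x ord0 i <= x ord0 i + u ord0 i by rewrite lerDl.
(* The bounds are ordered because [x_i] lies between them; this is where [l0] and [u0] enter. *)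
pose s : 'rV[citv R]_n := \row_i @CItv R (_, _) (le_trans (lex i) (xle i)).
have slo i : lo (s ord0 i) = x ord0 i - l ord0 i by rewrite mxE.
have shi i : hi (s ord0 i) = x ord0 i + u ord0 i by rewrite mxE.
have sS S : S != finset.set0 -> \sum_(i in S) s ord0 i ⪰ w S.
  move=> S0; split; rewrite ?lo_sum ?hi_sum.
    by rewrite (eq_bigr _ (fun i _ => slo i)); apply: lS.
  by rewrite (eq_bigr _ (fun i _ => shi i)); apply: uS.
exists s; last first.
  by move=> i; rewrite /citv_set /= in_itv /= slo shi lex xle.
split=> //; split=> [|i].
  apply: citv_eq; rewrite ?lo_sum ?hi_sum.
    by rewrite (eq_bigr _ (fun i _ => slo i)).
  by rewrite (eq_bigr _ (fun i _ => shi i)).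
(* Individual rationality is the coalition bound at a singleton. *)
have := sS [set i]%SET; rewrite big_set1; apply.
by apply/set0Pn; exists i; rewrite finset.in_set1.
Qed.

Theorem theorem8 (R : realType) (n : nat) (w : interval_game R n) :
  gen (interval_core w) = selection_core w <->
  (forall x : 'rV[R]_n, selection_core w x ->
    exists l u : 'rV[R]_n,
      (forall i, 0 <= l ord0 i) /\
      (forall i, 0 <= u ord0 i) /\
      \sum_(i < n) (x ord0 i - l ord0 i) = lo (w [set: 'I_n]%SET) /\
      \sum_(i < n) (x ord0 i + u ord0 i) = hi (w [set: 'I_n]%SET) /\
      (forall S : {set 'I_n}, S != finset.set0 ->
        lo (w S) <= \sum_(i in S) (x ord0 i - l ord0 i)) /\
      (forall S : {set 'I_n}, S != finset.set0 ->
        hi (w S) <= \sum_(i in S) (x ord0 i + u ord0 i))).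
Proof.
split=> [E x|H]; first by rewrite -E => /gen_interval_coreP.
(* Only the inclusion of the selection core depends on [H]; the other one holds for every [w]. *)
apply/seteqP; split; first exact: gen_interval_core_sub.
by move=> x /H /gen_interval_coreP.
Qed.
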